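(* Let $H$ be a collection of probability measures on a measurable space $\mathcal{X}$, let $Q$ be a probability measure on $\mathcal{X}$ with generalized Lebesgue decomposition $Q=Q_a+Q_s$ with respect to $H$, and let $U^{\log}(x)=\log(x)$, $x\in[0,\infty]$. Suppose $Q_a(\mathcal{X})>0$. There exists a $U^{\log}$-optimal e-value, which is $Q_a$-almost surely unique and strictly positive. For a valid e-value $\varepsilon^{\log}\in\mathcal{E}(H)$, the following statements are equivalent: 1. $\varepsilon^{\log}$ is $U^{\log}$-optimal; 2. $\mathrm{E}^{Q_a}[\varepsilon/\varepsilon^{\log}-1]\le 0$ for every $\varepsilon\in\mathcal{E}(H)$; 3. there exists some $P^*\in H^{\mathrm{eff}}$ mutually absolutely continuous with $Q_a$ such that $$\varepsilon^{\log}=\frac{1}{Q_a(\mathcal{X})}\frac{dQ_a}{dP^*},\quad Q_a\text{-almost surely},$$ and $\mathrm{E}^{P^*}[\varepsilon^{\log}]=1$.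
   Context: Notation and conventions: $\mathrm{E}^\mu[f]=\int f\,d\mu$ for any nonnegative measure $\mu$; $\log 0=-\infty$, $\log\infty=\infty$; $x/0=\infty$ for $x>0$. An event is $H$-negligible if it has probability zero under every $P\in H$. The generalized Lebesgue decomposition of $Q$ with respect to $H$ is $Q=Q_a+Q_s$, where the nonnegative measure $Q_s$ is concentrated on an $H$-negligible event and the nonnegative measure $Q_a$ assigns zero mass to every $H$-negligible event. The class of valid e-values for $H$ is $\mathcal{E}(H)=\{\varepsilon:\mathcal{X}\to[0,\infty]\ \text{measurable}: \mathrm{E}^P[\varepsilon]\le 1\ \text{for all } P\in H\}$. With $M_+$ the collection of nonnegative measures on $\mathcal{X}$, the effective hypothesis is $H^{\mathrm{eff}}=\{P\in M_+: \mathrm{E}^P[\varepsilon]\le 1\ \text{for all } \varepsilon\in\mathcal{E}(H)\}$. For measurable $U:[0,\infty]\to[-\infty,\infty]$, a valid e-value $\varepsilon^*\in\mathcal{E}(H)$ is $U$-optimal (against $Q_a$) if, for every $\varepsilon\in\mathcal{E}(H)$, $\mathrm{E}^{Q_a}[U(\varepsilon^* )-U(\varepsilon)]$ is well-defined and $\ge 0$. Here ''well-defined'' means that the integrand avoids an ambiguous $\infty-\infty$ $Q_a$-almost surely, and that its positive part or its negative part has finite $Q_a$-expectation. *)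

(* Defs.v *)
From HB Require Import structures.
From mathcomp Require Import all_boot all_order all_algebra.
From mathcomp Require Import all_classical all_reals all_analysis.
From mathcomp Require Import measurable_realfun.
Set Implicit Arguments.
Unset Strict Implicit.
Unset Printing Implicit Defensive.
Import Order.TTheory GRing.Theory Num.Theory.
Import numFieldNormedType.Exports.
Local Open Scope classical_set_scope.
Local Open Scope ring_scope.
Local Open Scope ereal_scope.

Definition H_negligible (d : measure_display) (X : measurableType d)
    (R : realType) (H : set (probability X R)) (A : set X) : Prop :=
  measurable A /\ forall P : probability X R, H P -> P A = 0.

Definition generalized_Lebesgue_decomposition (d : measure_display)
    (X : measurableType d) (R : realType) (H : set (probability X R))
    (Q : probability X R) (Qa Qs : {measure set X -> \bar R}) : Prop :=
  [/\ forall A, measurable A -> Q A = Qa A + Qs A,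
      exists N, H_negligible H N /\ Qs (~` N) = 0
    & forall A, H_negligible H A -> Qa A = 0].

Definition evalues (d : measure_display) (X : measurableType d)
    (R : realType) (H : set (probability X R)) : set (X -> \bar R) :=
  [set e : X -> \bar R | [/\ measurable_fun [set: X] e,
               forall x, 0 <= e x
             & forall P : probability X R, H P -> \int[P]_x e x <= 1]].

Definition effective_hypothesis (d : measure_display) (X : measurableType d)
    (R : realType) (H : set (probability X R)) :
    set {measure set X -> \bar R} :=
  [set P : {measure set X -> \bar R} | forall e, evalues H e -> \int[P]_x e x <= 1].

Definition well_defined_expectation_diff (d : measure_display)
    (X : measurableType d) (R : realType) (mu : {measure set X -> \bar R})
    (f g : X -> \bar R) : Prop :=
  {ae mu, forall x, f x +? - g x} /\
  (\int[mu]_x (f \- g)^\+ x < +oo \/ \int[mu]_x (f \- g)^\- x < +oo).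

(* A utility is a function on [0, +oo]; since e-values are nonnegative, the
   values of [U : \bar R -> \bar R] at negative arguments play no role. *)
Definition U_optimal (d : measure_display) (X : measurableType d)
    (R : realType) (H : set (probability X R))
    (Qa : {measure set X -> \bar R}) (U : \bar R -> \bar R)
    (estar : X -> \bar R) : Prop :=
  evalues H estar /\
  forall e, evalues H e ->
    well_defined_expectation_diff Qa (U \o estar) (U \o e) /\
    0 <= \int[Qa]_x (U (estar x) - U (e x)).

(* The constant 1 is an e-value, so every member of the effective hypothesis
   has total mass at most 1. Hence Radon-Nikodym derivatives with respect to
   its members can be taken with the library's derivative, whose denominator
   is a bundled sigma-finite measure. *)
Lemma effective_hypothesis_le1 (d : measure_display) (X : measurableType d)
    (R : realType) (H : set (probability X R))
    (P : {measure set X -> \bar R}) :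
  effective_hypothesis H P -> P [set: X] <= 1.
Proof.
move=> /(_ (cst 1)); rewrite integral_cst// mul1e; apply; split.
- exact: measurable_cst.
- by move=> x /=; exact: lee01.
- by move=> P' _; rewrite integral_cst// mul1e probability_le1.
Qed.

(* Main.v *)
Require Import Defs.
From HB Require Import structures.
From mathcomp Require Import all_boot all_order all_algebra.
From mathcomp Require Import all_classical all_reals all_analysis.
From mathcomp Require Import measurable_realfun.
From mathcomp Require Import ring lra.
Set Implicit Arguments.
Unset Strict Implicit.
Unset Printing Implicit Defensive.
Import Order.TTheory GRing.Theory Num.Theory.
Import numFieldNormedType.Exports.
Local Open Scope classical_set_scope.
Local Open Scope ring_scope.
Local Open Scope charge_scope.
Local Open Scope ereal_scope.

(** Write q for the total mass of Qa, and call an e-value f a numeraire if the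
    Qa-integral of e / f is at most q for every e-value e; this is the second
    condition of the theorem.  Every part of the theorem is a statement about
    numeraires.

    Logarithmic optimality is the same as being a numeraire.  Since
    ln y <= y - 1, a numeraire satisfies E[ln (e / f)] <= E[e / f - 1] <= 0.
    Conversely e-values form a convex set, so an optimal f beats the mixtures
    (1 - t) f + t e; the inequality ln w >= 1 - 1/w turns this into a bound on
    the integral of e / ((1 - t) f + t e) ([first_order]), and Fatou's lemma
    lets t tend to 0.  Uniqueness holds because f / g + g / f >= 2, with
    equality only where f = g.

    The dual measure of a numeraire f is the one with density 1 / (q f) with
    respect to Qa: being in the effective hypothesis is then literally the
    numeraire inequality, and in the other direction the inequality is a change
    of variables.

    Existence is the substance.  The supremum of E[ln e] may be infinite, so
    one maximizes, up to an error r_n ^ 2 with r_n = 1 / 2 ^ (n + 1), over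
    e-values with values in [1/N_n, N_n], where N_n increases to infinity.
    Strict concavity of ln makes these near-maximizers f_n a Cauchy sequence.
    Compare f_n and f_(n+1) with their midpoint, brought within the bounds of
    step n for the comparison with f_n: up to the small cost of restoring the
    bounds, the gain in logarithm dominates the square of
    |f_n - f_(n+1)| / (f_n + f_(n+1)), except where f_(n+1) exceeds N_n
    ([log_gain]).  That exceptional set is small uniformly, because e-values are
    bounded in Qa-measure: otherwise a convergent mixture of e-values would be
    infinite on a non-null set, whereas an e-value is infinite only on an
    H-negligible event.  So f_n converges Qa-almost everywhere.  Its pointwise
    lower limit g is defined everywhere and is an e-value by Fatou's lemma under
    each P in H, although nothing is known about convergence under P.
    Finally mix f_n with weight r_n in [first_order]: its error term is then of
    order r_n ^ 2 / r_n = r_n, and the limit shows that g is a numeraire. *)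

(** * Integrals and lower limits *)

Section preliminaries.
Context (d : measure_display) (X : measurableType d) (R : realType).
Implicit Types (mu : {measure set X -> \bar R}) (f g : X -> \bar R).

(** The tangent bound ln v <= v - 1 read at v = 1 / w.  In this form a comparison
    of logarithms turns into a comparison of ratios. *)
Lemma ln_ge1BV (w : R) : (0 < w)%R -> (1 - w^-1 <= ln w)%R.
Proof.
move=> w0; have := @le_ln1Dx R (w^-1 - 1)%R.
rewrite subrKC lnV ?posrE// => /(_ _); have : (0 < w^-1)%R by rewrite invr_gt0.
move=> wV h; have {}h : (- ln w <= w^-1 - 1)%R by apply: h; lra.
lra.
Qed.

Lemma measurable_lne : measurable_fun [set: \bar R] (@lne R).
Proof.
rewrite (_ : @lne R = fun x => if x == +oo then +oo else
  if x <= 0 then -oo else (ln (fine x))%:E); last first.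
  by apply/funext => -[r| |]//=; rewrite leNye.
apply: measurable_fun_ifT => //.
  exact: measurable_fun_eqe.
apply: measurable_fun_ifT => //.
  exact: measurable_fun_lee.
by apply/measurable_EFinP; apply: measurableT_comp; first exact: measurable_ln.
Qed.

Lemma ge0_measurable_inve f : measurable_fun [set: X] f ->
  (forall x, 0 <= f x) -> measurable_fun [set: X] (fun x => (f x)^-1).
Proof.
move=> mf f0.
(* for nonnegative reals, 0 included, the inverse is the power with exponent -1 *)
rewrite (_ : (fun _ => _) = fun x => if f x == 0 then +oo else
  ((fine (f x)) `^ (- 1))%:E); last first.
  apply/funext => x; case: (f x) (f0 x) => [r| |]//=; last first.
    by rewrite invey powR0// oppr_eq0 oner_eq0.
  by rewrite lee_fin => r0; rewrite powR_inv1// inver eqe.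
apply: measurable_fun_ifT => //.
  exact: measurable_fun_eqe.
apply/measurable_EFinP.
apply: (measurableT_comp (f := @powR R ^~ (- 1)%R)) => //.
exact: measurableT_comp.
Qed.

(** Extended addition is monotone also at oo - oo, which covers functions that are
    not integrable. *)
Lemma ae_le_integral mu f g :
  measurable_fun [set: X] f -> measurable_fun [set: X] g ->
  {ae mu, forall x, f x <= g x} -> \int[mu]_x f x <= \int[mu]_x g x.
Proof.
move=> mf mg fg; rewrite integralE [leRHS]integralE; apply: leeB.
  apply: ae_ge0_le_integral => //; [exact: measurable_funepos|
    exact: measurable_funepos|].
  apply: filterS fg => x fgx _.
  by rewrite !funeposE ge_max !le_max fgx lexx orbT.
apply: ae_ge0_le_integral => //; [exact: measurable_funeneg|
    exact: measurable_funeneg|].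
apply: filterS fg => x fgx _.
by rewrite !funenegE ge_max !le_max leeN2 fgx lexx orbT.
Qed.

Lemma measurable_reldiff (f g : X -> R) :
  measurable_fun [set: X] f -> measurable_fun [set: X] g ->
  (forall x, (0 < f x)%R) -> (forall x, (0 < g x)%R) ->
  measurable_fun [set: X] (fun x => (`|f x - g x| / (f x + g x))%:E).
Proof.
move=> mf mg f0 g0; rewrite (_ : (fun _ => _) =
    fun x => (`|f x - g x|)%:E / (f x + g x)%:E); last first.
  by apply/funext => x; rewrite inver gt_eqF ?addr_gt0.
apply: emeasurable_funM.
  apply/measurable_EFinP; apply: measurableT_comp => //.
  exact: measurable_funB.
apply: ge0_measurable_inve.
  by apply/measurable_EFinP; exact: measurable_funD.
by move=> x; rewrite lee_fin addr_ge0// ltW.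
Qed.

Lemma measurable_limn_einf (y : (X -> \bar R)^nat) :
  (forall n, measurable_fun [set: X] (y n)) ->
  measurable_fun [set: X] (fun x => limn_einf (y ^~ x)).
Proof.
move=> my.
rewrite (_ : (fun _ => _) = fun x => - limn_esup (fun n => - y n x))//.
apply: measurableT_comp => //; apply: measurable_fun_limn_esup => n.
exact: measurableT_comp.
Qed.

Lemma limn_einf_ge0 (u : (\bar R)^nat) : (forall n, 0 <= u n) -> 0 <= limn_einf u.
Proof.
move=> u0; rewrite limn_einf_lim; apply: lime_ge; first exact: is_cvg_einfs.
by apply: nearW => n; apply: le_ereal_inf_tmp => _ [m _ <-].
Qed.

Lemma le_limn_einf (u v : (\bar R)^nat) : (forall n, u n <= v n) ->
  limn_einf u <= limn_einf v.
Proof.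
move=> uv; rewrite !limn_einf_lim; apply: lee_lim; try exact: is_cvg_einfs.
apply: nearW => n; apply: le_ereal_inf_tmp => _ [m /= nm <-].
by apply: le_trans (uv m); apply: ereal_inf_lbound; exists m.
Qed.

Lemma fatou_le mu (y : (X -> \bar R)^nat) (z : X -> \bar R) (u : (\bar R)^nat) l :
  (forall n, measurable_fun [set: X] (y n)) -> (forall n x, 0 <= y n x) ->
  measurable_fun [set: X] z -> (forall x, 0 <= z x) ->
  {ae mu, forall x, z x <= limn_einf (y ^~ x)} ->
  (forall n, \int[mu]_x y n x <= u n) -> u n @[n --> \oo] --> l ->
  \int[mu]_x z x <= l.
Proof.
move=> my y0 mz z0 zy yu ul.
apply: le_trans (_ : \int[mu]_x limn_einf (y ^~ x) <= _); last first.
  apply: le_trans (fatou _ _ _ _) _ => //.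
  by rewrite -(cvg_limn_einf_sup ul).1; exact: le_limn_einf.
apply: ae_ge0_le_integral => //.
- by move=> x _; exact: limn_einf_ge0.
- exact: measurable_limn_einf.
- by apply: filterS zy => x + _.
Qed.

Lemma ae_dominates (P Q : {measure set X -> \bar R}) (A : X -> Prop) :
  Q `<< P -> {ae P, forall x, A x} -> {ae Q, forall x, A x}.
Proof.
move=> /null_content_dominatesP QP [N [mN PN subN]].
by exists N; split => //; exact: QP.
Qed.

Lemma finite_measureT_EFin (mu : {finite_measure set X -> \bar R}) :
  exists q, mu [set: X] = q%:E.
Proof. by exists (fine (mu [set: X])); rewrite fineK// fin_num_measure. Qed.

End preliminaries.

(** * Convergence of positive real sequences *)

Section real_sequences.
Context (R : realType).
Local Open Scope ring_scope.
Implicit Types f s : R^nat.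

Lemma nneseries_lty_is_cvg s : (forall n, 0 <= s n) ->
  (\sum_(n <oo) (s n)%:E < +oo)%E -> cvgn (series s).
Proof.
move=> s0 soo; apply: nondecreasing_is_cvgn.
  move=> m n mn; rewrite /series/= (big_cat_nat _ mn)//= lerDl.
  by apply: sumr_ge0 => i _; exact: s0.
exists (fine (\sum_(n <oo) (s n)%:E)%E) => _ [n _ <-].
rewrite -lee_fin fineK; last first.
  by rewrite ge0_fin_numE// nneseries_ge0// => i _ _; rewrite lee_fin.
rewrite /series/= -sumEFin; apply: nneseries_lim_ge => i _ _.
by rewrite lee_fin.
Qed.

(** Relative increments control the increments of 1 / (1 + f n), which is
    therefore convergent; a limit 0 of this transform means divergence of f. *)
Lemma cvg_of_summable_reldiff f : (forall n, 0 < f n) ->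
  (\sum_(n <oo) (`|f n - f n.+1| / (f n + f n.+1))%:E < +oo)%E ->
  (exists2 a : R, 0 <= a & f n @[n --> \oo] --> a) \/
  f n @[n --> \oo] --> +oo.
Proof.
move=> f0 soo; pose u n := (1 + f n)^-1.
have p0 n : 0 < 1 + f n by rewrite addr_gt0.
have u0 n : 0 < u n by rewrite invr_gt0.
have fE : f = fun n => (u n)^-1 - 1.
  by apply/funext => n; rewrite /u invrK; ring.
have cu : cvgn u.
  have cs : cvgn (series (telescope u)).
    apply: normed_cvg.
    have r0 n : 0 <= `|f n - f n.+1| / (f n + f n.+1).
      by rewrite divr_ge0// ltW// addr_gt0.
    apply: series_le_cvg (nneseries_lty_is_cvg r0 soo) => n //=.
    rewrite /telescope /u/=.
    have -> : (1 + f n.+1)^-1 - (1 + f n)^-1 =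
        (f n - f n.+1) / ((1 + f n) * (1 + f n.+1)).
      by field; rewrite !gt_eqF.
    rewrite normrM ler_wpM2l// ger0_norm; last first.
      by rewrite invr_ge0 mulr_ge0// ltW.
    rewrite lef_pV2 ?posrE ?mulr_gt0 ?addr_gt0//.
    by have := f0 n; have := f0 n.+1; nra.
  have -> : u = (fun n => u 0%N + series (telescope u) n).
    by apply/funext => n; rewrite -eq_sum_telescope.
  by apply: is_cvgD => //; exact: is_cvg_cst.
move: cu => /cvg_ex[l /= ul].
have l0 : 0 <= l by apply: (cvgr_to_ge ul); apply: nearW => n; exact: ltW.
move: l0; rewrite le_eqVlt => /predU1P[l0|l0].
  right; rewrite fE; under eq_fun do rewrite addrC.
  apply/cvgryPge => M.
  have /cvgryPge/(_ (M + 1)) : (u n)^-1 @[n --> \oo] --> +oo.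
    by apply/cvgrVy; [exact: nearW|rewrite l0].
  by apply: filterS => n; lra.
left; exists (l^-1 - 1).
  rewrite subr_ge0 invf_ge1//.
  apply: (cvgr_to_le ul); apply: nearW => n.
  by rewrite /u invf_le1// lerDl ltW.
rewrite fE; apply: cvgB; last exact: cvg_cst.
by apply/cvgVP => //; rewrite gt_eqF.
Qed.

Lemma cvg_mix_ratio (t F B : R^nat) (a b : R) : 0 < a ->
  t n @[n --> \oo] --> 0 -> F n @[n --> \oo] --> a -> B n @[n --> \oo] --> b ->
  (B n / ((1 - t n) * F n + t n * B n)) @[n --> \oo] --> (b / a).
Proof.
move=> a0 tt FF BB.
have -> : (b / a = b / ((1 - 0) * a + 0 * b)) by rewrite subr0 mul1r mul0r addr0.
apply: cvgM => //; apply: cvgV.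
  by rewrite subr0 mul1r mul0r addr0 gt_eqF.
apply: cvgD; apply: cvgM => //.
by apply: cvgB => //; exact: cvg_cst.
Qed.

End real_sequences.

(** * Closure properties of the set of e-values *)

Section evalue_closure.
Context (d : measure_display) (X : measurableType d) (R : realType).
Variable H : set (probability X R).
Implicit Types (e f : X -> \bar R).

Lemma evalue_cst1 : evalues H (cst 1).
Proof.
split; [exact: measurable_cst|by move=> x /=; exact: lee01|].
by move=> P _; rewrite integral_cst// mul1e probability_le1.
Qed.

Lemma evalue_cst0 : evalues H (cst 0).
Proof.
by split => // P _; rewrite integral_cst// mul0e.
Qed.

Lemma evalue_le e f : evalues H e -> measurable_fun [set: X] f ->
  (forall x, 0 <= f x) -> (forall x, f x <= e x) -> evalues H f.
Proof.
move=> [me e0 eH] mf f0 fe; split => // P /eH; apply: le_trans.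
exact: ge0_le_integral.
Qed.

Lemma evalue_convex (t : R) e f : (0 <= t <= 1)%R -> evalues H e ->
  evalues H f -> evalues H (fun x => (1 - t)%:E * f x + t%:E * e x).
Proof.
move=> /andP[t0 t1] [me e0 eH] [mf f0 fH].
have t'0 : (0 <= 1 - t)%R by rewrite subr_ge0.
have mZ (c : R) g : measurable_fun [set: X] g ->
    measurable_fun [set: X] (fun x => c%:E * g x).
  by move=> mg; apply: emeasurable_funM.
split=> [|x|P HP].
- by apply: emeasurable_funD; exact: mZ.
- by rewrite adde_ge0 ?mule_ge0.
rewrite ge0_integralD//; [|by move=> x _; rewrite mule_ge0|exact: mZ
  |by move=> x _; rewrite mule_ge0|exact: mZ].
rewrite !ge0_integralZl_EFin//.
have -> : 1 = (1 - t)%:E * 1 + t%:E * 1 :> \bar R.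
  by rewrite !mule1 -EFinD subrK.
by apply: leeD; apply: lee_wpmul2l => //; [exact: fH|exact: eH].
Qed.

(** The lower limit is taken at every point, so Fatou's lemma acts under all P in H
    at once, although these measures may have different null sets. *)
Lemma evalue_limn_einf (e : (X -> \bar R)^nat) : (forall n, evalues H (e n)) ->
  evalues H (fun x => limn_einf (e ^~ x)).
Proof.
move=> eH; have me n : measurable_fun [set: X] (e n) by case: (eH n).
have e0 n x : 0 <= e n x by case: (eH n).
split=> [|x|P HP].
- exact: measurable_limn_einf.
- exact: limn_einf_ge0.
apply: (@fatou_le _ _ _ P e _ (cst 1)) => //; try exact: cvg_cst.
- exact: measurable_limn_einf.
- by move=> x; exact: limn_einf_ge0.
- by apply: aeW => x.
- by move=> n; case: (eH n) => _ _; exact.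
Qed.

Lemma evalue_series (e : (X -> \bar R)^nat) : (forall n, evalues H (e n)) ->
  evalues H (fun x => \sum_(n <oo) ((1 / (2 ^ n.+1)%:R)%:E * e n x)).
Proof.
move=> eH; have me n : measurable_fun [set: X] (e n) by case: (eH n).
have e0 n x : 0 <= e n x by case: (eH n).
have mce n : measurable_fun [set: X] (fun x => (1 / (2 ^ n.+1)%:R)%:E * e n x).
  by apply: emeasurable_funM.
have ce0 n x : 0 <= (1 / (2 ^ n.+1)%:R)%:E * e n x.
  by rewrite mule_ge0// lee_fin divr_ge0.
split=> [|x|P HP].
- exact: ge0_emeasurable_sum.
- exact: nneseries_ge0.
rewrite integral_nneseries//.
apply: le_trans (_ : \sum_(n <oo) (1 / (2 ^ n.+1)%:R)%:E <= _); last first.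
  exact: epsilon_trick0.
apply: lee_nneseries => [n _ _|n _]; first exact: integral_ge0.
rewrite ge0_integralZl_EFin// ?divr_ge0//.
by rewrite -[leRHS]mule1 lee_wpmul2l ?lee_fin ?divr_ge0//; case: (eH n) => _ _; exact.
Qed.

End evalue_closure.

(** * Numeraires and the first-order condition *)

Section numeraire.
Context (d : measure_display) (X : measurableType d) (R : realType).
Variables (H : set (probability X R)) (mu : {finite_measure set X -> \bar R}).
Hypothesis mu_ac : forall A, H_negligible H A -> mu A = 0.
Implicit Types (e f g : X -> \bar R).

(** The event where e is infinite is null under each P in H by integrability,
    hence H-negligible, hence null for a measure that ignores such events. *)
Lemma evalue_lty e : evalues H e -> {ae mu, forall x, e x < +oo}.
Proof.
move=> [me e0 eH]; pose A := [set x | e x = +oo].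
have mA : measurable A.
  by rewrite -[A]setTI; exact: (me measurableT [set +oo]).
exists A; split => //; last first.
  by move=> x /= /negP; rewrite -leNgt leye_eq => /eqP.
apply: mu_ac; split => // P HP.
have eP : P.-integrable [set: X] e.
  apply/integrableP; split => //; under eq_integral do rewrite gee0_abs//.
  by apply: le_lt_trans (eH _ HP) _; rewrite ltry.
apply: measure_negligible => //.
have := integrable_ae measurableT eP; apply: negligibleS => x /= ->.
by move=> /(_ I).
Qed.

(** The integral of g - 1 is meaningful even when g is not integrable, because its
    negative part is at most 1. *)
Lemma integral_sub1_le0 g : measurable_fun [set: X] g ->
  (forall x, 0 <= g x) ->
  (\int[mu]_x (g x - 1) <= 0) = (\int[mu]_x g x <= mu [set: X]).
Proof.
move=> mg g0; pose h x := g x - 1.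
have mh : measurable_fun [set: X] h by apply: emeasurable_funB.
have hn : \int[mu]_x h^\- x <= mu [set: X].
  rewrite -[leRHS]mul1e -integral_cst//; apply: ge0_le_integral => //.
    exact: measurable_funeneg.
  move=> x _ /=; rewrite funenegE ge_max lee01 andbT /h.
  have := g0 x; case: (g x) => [r| |]//=; rewrite ?leNye// !lee_fin => r0.
  lra.
have qfin : mu [set: X] \is a fin_num by exact: fin_num_measure.
have hfin : \int[mu]_x h^\- x \is a fin_num.
  rewrite ge0_fin_numE ?integral_ge0//.
  by apply: le_lt_trans hn _; rewrite ltey_eq qfin.
have : \int[mu]_x g x + \int[mu]_x h^\- x = \int[mu]_x h^\+ x + mu [set: X].
  rewrite -[mu _]mul1e -integral_cst// -!ge0_integralD//;
    [|exact: measurable_funepos|exact: measurable_funeneg].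
  apply: eq_integral => x _; rewrite funeposE funenegE /h.
  have := g0 x; case: (g x) => [r| |]//= r0; last first.
    by rewrite maxNye maxye.
  rewrite -!EFinD -!EFin_max -!EFinD; congr EFin.
  by case: (leP (r - 1)%R 0%R) => ?; case: (leP (- (r - 1))%R 0%R) => ?; lra.
have hp : 0 <= \int[mu]_x h^\+ x by exact: integral_ge0.
have gp : 0 <= \int[mu]_x g x by exact: integral_ge0.
rewrite [X in (X <= 0) = _]integralE -/h.
move: hp gp hfin qfin; case: (\int[mu]_x h^\+ x) => [p| |]//;
case: (\int[mu]_x h^\- x) => [n| |]//; case: (mu [set: X]) => [q| |]//;
case: (\int[mu]_x g x) => [k| |]// _ _ _ _.
by rewrite -EFinB -!EFinD !lee_fin => -[] ?; apply/idP/idP; lra.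
Qed.

Definition numeraire f :=
  evalues H f /\ forall e, evalues H e -> \int[mu]_x (e x / f x) <= mu [set: X].

Lemma measurable_evalue_ratio e f : evalues H e -> evalues H f ->
  measurable_fun [set: X] (fun x => e x / f x).
Proof.
by move=> [me _ _] [mf f0 _]; apply: emeasurable_funM => //;
  exact: ge0_measurable_inve.
Qed.

Lemma evalue_ratio_ge0 e f x : evalues H e -> evalues H f -> 0 <= e x / f x.
Proof. by move=> [_ e0 _] [_ f0 _]; rewrite mule_ge0// inve_ge0. Qed.

Lemma numeraireP f : evalues H f -> numeraire f <->
  forall e, evalues H e -> \int[mu]_x (e x / f x - 1) <= 0.
Proof.
move=> fH; split=> [[_ fN] e eH|fN].
  rewrite integral_sub1_le0 ?fN//; first exact: measurable_evalue_ratio.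
  by move=> x; exact: evalue_ratio_ge0.
split => // e eH; rewrite -integral_sub1_le0 ?fN//.
  exact: measurable_evalue_ratio.
by move=> x; exact: evalue_ratio_ge0.
Qed.

(** The constant 1 is an e-value and 1 / 0 is infinite. *)
Lemma numeraire_gt0 f : numeraire f -> {ae mu, forall x, 0 < f x}.
Proof.
move=> [fH fN]; have [mf f0 _] := fH.
have h : mu.-integrable [set: X] (fun x => (f x)^-1).
  apply/integrableP; split; first exact: ge0_measurable_inve.
  under eq_integral do rewrite gee0_abs ?inve_ge0// -[_^-1]mul1e.
  apply: le_lt_trans (fN _ (evalue_cst1 H)) _.
  by rewrite ltey_eq fin_num_measure.
have := integrable_ae measurableT h; apply: filterS => x /(_ I).
rewrite lt_def f0 andbT; apply: contraTN => /eqP ->.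
by rewrite inve0.
Qed.

Lemma evalues_real_ae e f : evalues H e -> evalues H f ->
  {ae mu, forall x, 0 < f x} ->
  {ae mu, forall x, exists a b : R,
    [/\ (0 < a)%R, (0 <= b)%R, f x = a%:E & e x = b%:E]}.
Proof.
move=> eH fH fpos.
move: (evalue_lty eH) (evalue_lty fH) fpos.
apply: filterS3 => x ey fy fp.
exists (fine (f x)), (fine (e x)); have [_ e0 _] := eH; have [_ f0 _] := fH.
by rewrite fine_ge0// fine_gt0 ?fp// !fineK// ge0_fin_numE.
Qed.

(** First-order condition with an error term.  Along the segment from f to e, write
    w for (1 - t) f + t e.  By ln_ge1BV, ln f - ln w <= f / w - 1, and the right
    side equals t / (1 - t) * (1 - e / w); so if mixing with e improves the
    expected logarithm by at most eps, the integral of e / w is bounded. *)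
Lemma first_order (t eps : R) e f : (0 < t < 1)%R ->
  evalues H e -> evalues H f -> {ae mu, forall x, 0 < f x} ->
  (- eps)%:E <=
    \int[mu]_x (lne (f x) - lne ((1 - t)%:E * f x + t%:E * e x)) ->
  \int[mu]_x (e x / ((1 - t)%:E * f x + t%:E * e x)) <=
    mu [set: X] + (eps * ((1 - t) / t))%:E.
Proof.
move=> /andP[t0 t1] eH fH fpos.
set ft := fun x => (1 - t)%:E * f x + t%:E * e x.
have ftH : evalues H ft by apply: evalue_convex => //; rewrite !ltW.
pose y x := e x / ft x.
have my : measurable_fun [set: X] y by exact: measurable_evalue_ratio.
have y0 x : 0 <= y x by exact: evalue_ratio_ge0.
have real_ae := evalues_real_ae eH fH fpos.
have ftE x a b : f x = a%:E -> e x = b%:E -> ft x = ((1 - t) * a + t * b)%:E.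
  by rewrite /ft => -> ->; rewrite -!EFinM -EFinD.
have yint : mu.-integrable [set: X] y.
  apply/integrableP; split => //.
  under eq_integral do rewrite gee0_abs//.
  apply: le_lt_trans (_ : \int[mu]_x (cst t^-1%:E) x < +oo); last first.
    by rewrite integral_cst// lte_mul_pinfty ?lee_fin ?invr_ge0 ?ltW//
      ltey_eq fin_num_measure.
  apply: ae_ge0_le_integral => //.
    by move=> x _ /=; rewrite lee_fin invr_ge0 ltW.
  apply: filterS real_ae => x [a [b [a0 b0 fE eE]]] _.
  have w0 : (0 < (1 - t) * a + t * b)%R by nra.
  rewrite /y (ftE x a b)// eE inver gt_eqF// -EFinM lee_fin/=.
  rewrite ler_pdivrMr// mulrC ler_pdivlMr//; nra.
have t'0 : (0 < 1 - t)%R by rewrite subr_gt0.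
set c := (t / (1 - t))%R; have c0 : (0 < c)%R by rewrite divr_gt0.
have my1 : measurable_fun [set: X] (fun x => c%:E * (1 - y x)).
  by apply: emeasurable_funM => //; apply: emeasurable_funB.
have i1y : mu.-integrable [set: X] (fun x => 1 - y x).
  by apply: integrableB => //; exact: finite_measure_integrable_cst.
move=> epsle; have {epsle} : (- eps)%:E <= \int[mu]_x (c%:E * (1 - y x)).
  apply: le_trans epsle _; apply: ae_le_integral => //.
    by apply: emeasurable_funB; apply: measurableT_comp => //;
      [exact: measurable_lne|case: fH|exact: measurable_lne|case: ftH].
  apply: filterS real_ae => x [a [b [a0 b0 fE eE]]].
  have w0 : (0 < (1 - t) * a + t * b)%R by nra.
  rewrite -/(ft x) /y (ftE x a b)// eE fE !lne_EFin// inver gt_eqF//.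
  rewrite -!EFinM -!EFinD lee_fin.
  have := @ln_ge1BV R (((1 - t) * a + t * b) / a) (divr_gt0 w0 a0).
  rewrite ln_div ?posrE// invf_div => lnle.
  have -> : (c * (1 + - (b / ((1 - t) * a + t * b))) =
      a / ((1 - t) * a + t * b) - 1)%R.
    by rewrite /c; field; rewrite !gt_eqF.
  lra.
rewrite integralZl//= integralB//; last first.
  exact: finite_measure_integrable_cst.
have [q qE] := finite_measureT_EFin mu.
have [Y YE] : exists Y, \int[mu]_x y x = Y%:E.
  by exists (fine (\int[mu]_x y x)); rewrite fineK//; exact: integrable_fin_num.
rewrite integral_cst// mul1e [X in _ -> X <= _](_ : _ = \int[mu]_x y x)//.
rewrite YE [X in X - _]qE [X in _ -> _ <= X + _]qE.
rewrite -EFinB -EFinM -EFinD !lee_fin => h.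
have -> : (eps * ((1 - t) / t) = eps / c)%R by rewrite /c invf_div.
by rewrite -lerBlDl ler_pdivlMr//; lra.
Qed.

End numeraire.

(** * Logarithmic optimality *)

Section optimality.
Context (d : measure_display) (X : measurableType d) (R : realType).
Variables (H : set (probability X R)) (mu : {finite_measure set X -> \bar R}).
Hypothesis mu_ac : forall A, H_negligible H A -> mu A = 0.
Implicit Types (e f g : X -> \bar R).

(** Optimality against the mixtures (1 - t) f + t e with t = 1 / (n + 2), followed
    by Fatou's lemma. *)
Lemma optimal_numeraire f : U_optimal H mu (@lne R) f -> numeraire H mu f.
Proof.
move=> [fH fopt]; split => // e eH.
have [mf f0 _] := fH; have [me e0 _] := eH.
have fpos : {ae mu, forall x, 0 < f x}.
  (* against the e-value 0 the difference ln f - ln 0 is defined only if f > 0 *)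
  have [[+ _] _] := fopt _ (evalue_cst0 H); apply: filterS => x /=.
  rewrite lt_def f0 andbT lexx/=; apply: contraTN => /eqP ->.
  by rewrite /= lexx.
pose t n : R := (n.+2%:R^-1)%R.
have t01 n : (0 < t n < 1)%R.
  by rewrite /t invr_gt0 ltr0n/= invf_lt1 ?ltr1n ?ltr0n.
pose ft n x := (1 - t n)%:E * f x + (t n)%:E * e x.
have ftH n : evalues H (ft n).
  by have /andP[t0 t1] := t01 n; apply: evalue_convex => //; rewrite !ltW.
apply: (@fatou_le _ _ _ mu (fun n x => e x / ft n x) _ (cst (mu [set: X]))).
- by move=> n; exact: measurable_evalue_ratio eH (ftH n).
- by move=> n x; exact: evalue_ratio_ge0 eH (ftH n).
- exact: measurable_evalue_ratio eH fH.
- by move=> x; exact: evalue_ratio_ge0 eH fH.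
- apply: filterS (evalues_real_ae mu_ac eH fH fpos) => x [a [b [a0 b0 fE eE]]].
  rewrite fE eE inver gt_eqF// -EFinM.
  have -> : (fun n => b%:E / ft n x) =
      EFin \o (fun n => b / ((1 - t n) * a + t n * b))%R.
    apply/funext => n /=; rewrite /ft fE eE -!EFinM -EFinD inver gt_eqF//.
    by have /andP[? ?] := t01 n; nra.
  rewrite (cvg_limn_einf_sup (_ : _ --> (b / a)%:E)).1//.
  apply: cvg_EFin; first exact: nearW.
  apply: (@cvg_mix_ratio _ t (cst a) (cst b)) => //; try exact: cvg_cst.
  by have := @cvg_harmonic R; rewrite -cvg_shiftS.
- move=> n /=.
  have [_ le0] := fopt _ (ftH n).
  have := first_order mu_ac (t01 n) eH fH fpos (eps := 0).
  by rewrite oppr0 mul0r adde0; apply.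
- exact: cvg_cst.
Qed.

(** Almost everywhere ln f - ln e >= 1 - e / f, and the integral of the right side
    is nonnegative.  The same inequality bounds the negative part of the
    difference by e / f, so its expectation is well-defined. *)
Lemma numeraire_optimal f : numeraire H mu f -> U_optimal H mu (@lne R) f.
Proof.
move=> fN; have [fH fle] := fN; split => // e eH.
have rae := evalues_real_ae mu_ac eH fH (numeraire_gt0 fN).
have [mf f0 _] := fH; have [me e0 _] := eH.
have mr := measurable_evalue_ratio eH fH.
have r0 x := @evalue_ratio_ge0 _ _ _ _ e f x eH fH.
have mlef : measurable_fun [set: X] (fun x => lne (f x) - lne (e x)).
  by apply: emeasurable_funB; apply: measurableT_comp => //; exact: measurable_lne.
have rint : mu.-integrable [set: X] (fun x => e x / f x).
  apply/integrableP; split => //; under eq_integral do rewrite gee0_abs//.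
  by apply: le_lt_trans (fle _ eH) _; rewrite ltey_eq fin_num_measure.
have lnle : {ae mu, forall x, 1 - e x / f x <= lne (f x) - lne (e x)}.
  apply: filterS rae => x [a [b [a0 b0 -> ->]]].
  rewrite inver gt_eqF// lne_EFin// -EFinM -EFinD.
  move: b0; rewrite le_eqVlt => /predU1P[<-|b0].
    by rewrite le0_lneNy//= leey.
  rewrite lne_EFin// -EFinB lee_fin.
  have := @ln_ge1BV R (a / b) (divr_gt0 a0 b0).
  by rewrite ln_div ?posrE// invf_div.
split.
- split.
    apply: filterS rae => x [a [b [a0 b0 fE eE]]] /=.
    by rewrite fE eE lne_EFin// fin_num_adde_defr.
  right; apply: le_lt_trans (_ : \int[mu]_x (e x / f x) < +oo); last first.
    by apply: le_lt_trans (fle _ eH) _; rewrite ltey_eq fin_num_measure.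
  apply: ae_ge0_le_integral => //; first exact: measurable_funeneg.
  apply: filterS lnle => x xle _; rewrite funenegE ge_max r0 andbT /=.
  rewrite -(oppeK (e x / f x)) leeN2; apply: le_trans xle.
  by rewrite leeDr.
- apply: le_trans (_ : \int[mu]_x (1 - e x / f x) <= _); last first.
    apply: ae_le_integral => //.
    by apply: emeasurable_funB.
  have i1 : mu.-integrable [set: X] (cst 1 : X -> \bar R).
    exact: finite_measure_integrable_cst.
  rewrite integralB// integral_cst// mul1e.
  rewrite sube_ge0 ?fle//.
  by rewrite integrable_fin_num.
Qed.

Lemma optimalP f : U_optimal H mu (@lne R) f <-> numeraire H mu f.
Proof. by split; [exact: optimal_numeraire|exact: numeraire_optimal]. Qed.

(** If f and g are numeraires, f / g + g / f has integral at most twice the total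
    mass, whereas it is pointwise at least 2 with equality only if f = g. *)
Lemma numeraire_unique f g : numeraire H mu f -> numeraire H mu g ->
  {ae mu, forall x, f x = g x}.
Proof.
move=> fN gN; have [fH fle] := fN; have [gH gle] := gN.
have gpos := numeraire_gt0 gN.
have mfg := measurable_evalue_ratio fH gH.
have mgf := measurable_evalue_ratio gH fH.
have fg0 x := @evalue_ratio_ge0 _ _ _ _ f g x fH gH.
have gf0 x := @evalue_ratio_ge0 _ _ _ _ g f x gH fH.
have rae : {ae mu, forall x, exists a b : R,
    [/\ (0 < a)%R, (0 < b)%R, f x = a%:E & g x = b%:E]}.
  move: (numeraire_gt0 fN) (evalues_real_ae mu_ac fH gH gpos); apply: filterS2.
  move=> x + [b [a [b0 _ gE fE]]]; rewrite fE => a0.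
  by exists a, b; split.
(* the absolute value only makes k nonnegative everywhere: almost everywhere it
   can be removed *)
pose k x := `|f x / g x + g x / f x - 2%:E|.
have mk : measurable_fun [set: X] k.
  apply: measurableT_comp => //; apply: emeasurable_funB => //.
  exact: emeasurable_funD.
have kE : \int[mu]_x (k x + 2%:E) = \int[mu]_x (f x / g x + g x / f x).
  apply: ge0_ae_eq_integral => //.
  - by apply: emeasurable_funD.
  - by apply: emeasurable_funD.
  - by move=> x _; rewrite /k adde_ge0// ?abse_ge0// lee_fin.
  - by move=> x _; rewrite adde_ge0.
  apply: filterS rae => x [a [b [a0 b0 fE gE]]] _.
  rewrite /k fE gE !inver !gt_eqF// -!EFinM -!EFinD; congr EFin.
  rewrite ger0_norm ?subrK//.
  have -> : (a / b + b / a - 2 = (a - b) ^+ 2 / (a * b))%R.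
    by field; rewrite !gt_eqF.
  by rewrite divr_ge0 ?sqr_ge0// mulr_ge0 ?ltW.
have k0 : \int[mu]_x k x = 0.
  have [q qE] := finite_measureT_EFin mu.
  have fgq := gle _ fH; have gfq := fle _ gH.
  move: kE; rewrite !ge0_integralD//; last by move=> x _; rewrite ?abse_ge0 ?lee_fin.
  rewrite integral_cst// [X in _ + _ * X]qE => kE.
  apply/eqP; rewrite eq_le integral_ge0 ?andbT// => [|x _]; last exact: abse_ge0.
  have : \int[mu]_x k x + 2%:E * q%:E <= q%:E + q%:E.
    by rewrite kE; apply: leeD; rewrite -qE.
  case: (\int[mu]_x k x) => [r| |]//.
  by rewrite -EFinM -!EFinD !lee_fin; lra.
have : ae_eq mu [set: X] k (cst 0).
  apply/ae_eq_integral_abs => //.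
  by under eq_integral do rewrite abse_id.
move: rae; apply: filterS2 => x [a [b [a0 b0 fE gE]]] /(_ I).
rewrite /k fE gE !inver !gt_eqF// -!EFinM -!EFinD => /eqP.
rewrite abse_eq0 eqe => /eqP abE; congr EFin.
have : ((a - b) ^+ 2 / (a * b) = 0)%R.
  by rewrite -abE; field; rewrite !gt_eqF.
move=> /eqP; rewrite mulf_eq0 sqrf_eq0 invr_eq0 mulf_eq0 (gt_eqF a0) (gt_eqF b0) !orbF.
by rewrite subr_eq0 => /eqP.
Qed.

End optimality.

(** * Numeraires and the effective hypothesis *)

Section density.
Context (d : measure_display) (X : measurableType d) (R : realType).
Variables (mu : {finite_measure set X -> \bar R}) (w : X -> \bar R).
Hypothesis w0 : forall x, 0 <= w x.
Hypothesis wint : mu.-integrable [set: X] w.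

(** Nonnegativity and integrability of the density are arguments so that the
    measure instance below can be attached to this function. *)
Definition density & (forall x, 0 <= w x) & mu.-integrable [set: X] w :=
  fun A => \int[mu]_(x in A) w x.

Local Notation nu := (density w0 wint).

Let nu0 : nu set0 = 0.
Proof. exact: integral_set0. Qed.

Let nu_ge0 A : 0 <= nu A.
Proof. exact: integral_ge0. Qed.

Let nu_sigma_additive : semi_sigma_additive nu.
Proof.
by apply: semi_sigma_additive_nng_induced => //; exact: measurable_int wint.
Qed.

HB.instance Definition _ :=
  isMeasure.Build _ _ _ nu nu0 nu_ge0 nu_sigma_additive.

Let nu_fin : fin_num_fun nu.
Proof. by move=> A mA; apply: integrable_fin_num => //; exact: integrableS wint. Qed.

HB.instance Definition _ := Measure_isFinite.Build _ _ _ nu nu_fin.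

Lemma dominates_density : nu `<< mu.
Proof.
apply/null_content_dominatesP => A mA muA0.
apply: null_set_integral => //; apply: measurable_funTS.
exact: measurable_int wint.
Qed.

Lemma density_dominates : {ae mu, forall x, 0 < w x} -> mu `<< nu.
Proof.
move=> wpos; apply/null_content_dominatesP => A mA nuA0.
have mw := measurable_int _ wint.
have : ae_eq mu A w (cst 0).
  apply/ae_eq_integral_abs => //; first exact: measurable_funTS.
  by under eq_integral do rewrite gee0_abs//.
move=> w_eq0; apply: measure_negligible => //.
have : {ae mu, forall x, ~ A x}.
  move: wpos w_eq0; apply: filterS2 => x wx wE Ax.
  by move: wx; rewrite wE// ltxx.
by apply: negligibleS => x Ax; apply.
Qed.

Lemma ge0_integral_density (g : X -> \bar R) : (forall x, 0 <= g x) ->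
  measurable_fun [set: X] g -> \int[nu]_x g x = \int[mu]_x (g x * w x).
Proof.
move=> g0 mg; have mw := measurable_int _ wint.
rewrite -(Radon_Nikodym_SigmaFinite.change_of_variables dominates_density)//.
have mf : measurable_fun [set: X] (Radon_Nikodym_SigmaFinite.f nu mu).
  by apply: measurable_int (Radon_Nikodym_SigmaFinite.f_integrable _);
    exact: dominates_density.
apply: ge0_ae_eq_integral => //.
- exact: emeasurable_funM.
- exact: emeasurable_funM.
- move=> x _; rewrite mule_ge0// Radon_Nikodym_SigmaFinite.f_ge0//.
  exact: dominates_density.
- by move=> x _; rewrite mule_ge0.
apply: ae_eqe_mul2l; apply: integral_ae_eq => //.
- by apply: Radon_Nikodym_SigmaFinite.f_integrable; exact: dominates_density.
- move=> A _ mA; rewrite -Radon_Nikodym_SigmaFinite.f_integral//.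
  exact: dominates_density.
Qed.

End density.

Section duality.
Context (d : measure_display) (X : measurableType d) (R : realType).
Variables (H : set (probability X R)) (mu : {finite_measure set X -> \bar R}).
Hypothesis mu_ac : forall A, H_negligible H A -> mu A = 0.
Hypothesis mu_gt0 : 0 < mu [set: X].
Implicit Types (e f g : X -> \bar R).

Definition dual_measure f (P : {finite_measure set X -> \bar R}) :=
  [/\ effective_hypothesis H P, P `<< mu /\ mu `<< P,
    {ae mu, forall x, f x =
      (mu [set: X])^-1 * ('d (charge_of_finite_measure mu) '/d P) x}
    & \int[P]_x f x = 1].

(** With D the derivative of mu with respect to P and q the mass of mu, f = D / q,
    so integrating e / f against mu = D P leaves q times the integral of e
    against P. *)
Lemma dual_measure_numeraire f P : evalues H f -> dual_measure f P ->
  numeraire H mu f.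
Proof.
move=> fH [Peff [Pmu muP] fE _]; split => // e eH.
have [mf f0 _] := fH; have [me e0 _] := eH.
(* this version of the derivative is nonnegative everywhere, and has a change of
   variables formula for nonnegative integrands *)
pose D := Radon_Nikodym_SigmaFinite.f mu P.
have mD : measurable_fun [set: X] D.
  exact: measurable_int (Radon_Nikodym_SigmaFinite.f_integrable muP).
have [q qE] := finite_measureT_EFin mu.
have q0 : (0 < q)%R by rewrite -lte_fin -qE.
have D0 x : 0 <= D x by exact: Radon_Nikodym_SigmaFinite.f_ge0.
have cD0 x : 0 <= (q^-1)%:E * D x by rewrite mule_ge0// lee_fin invr_ge0 ltW.
have mcD : measurable_fun [set: X] (fun x => (q^-1)%:E * D x).
  exact: emeasurable_funM.
have fD : {ae mu, forall x, f x = (q^-1)%:E * D x}.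
  have := ae_dominates muP (ae_eq_Radon_Nikodym_SigmaFinite muP measurableT).
  move: fE; apply: filterS2 => x -> /(_ I) <-.
  by rewrite qE inver gt_eqF.
rewrite (_ : \int[mu]_x _ = \int[mu]_x (e x / ((q^-1)%:E * D x))); last first.
  apply: ge0_ae_eq_integral => //.
  - exact: measurable_evalue_ratio eH fH.
  - by apply: emeasurable_funM => //; exact: ge0_measurable_inve.
  - by move=> x _; exact: evalue_ratio_ge0 eH fH.
  - by move=> x _; rewrite mule_ge0// inve_ge0.
  - by apply: filterS fD => x ->.
rewrite -(Radon_Nikodym_SigmaFinite.change_of_variables muP)//; last 2 first.
  by move=> x; rewrite mule_ge0// inve_ge0.
  by apply: emeasurable_funM => //; exact: ge0_measurable_inve.
apply: le_trans (_ : \int[P]_x (q%:E * e x) <= _); last first.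
  rewrite ge0_integralZl_EFin//; last exact: ltW.
  rewrite [leRHS]qE -[leRHS]mule1.
  by apply: lee_wpmul2l; [rewrite lee_fin ltW|exact: Peff].
apply: ge0_le_integral => //.
- by move=> x _; rewrite !mule_ge0// inve_ge0.
- apply: emeasurable_funM => //.
  by apply: emeasurable_funM => //; exact: ge0_measurable_inve.
- exact: emeasurable_funM.
- move=> x _; rewrite -muleA [leRHS]muleC lee_wpmul2l// -/D.
  have := Radon_Nikodym_SigmaFinite.f_fin_num muP x; rewrite -/(D x).
  move: (D0 x); case: (D x) => [r| |]//; rewrite lee_fin -EFinM => r0 _.
  rewrite inver; case: ifPn => [/eqP|] h.
    have -> : r = 0%R.
      by move/eqP : h; rewrite mulf_eq0 invr_eq0 gt_eqF//= => /eqP.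
    by rewrite mule0 lee_fin ltW.
  rewrite -EFinM lee_fin; move: h; rewrite mulf_eq0 negb_or => /andP[_ rn0].
  by rewrite invfM invrK mulfVK.
Qed.

(** The dual measure has density w = 1 / (q f) with respect to mu: integrating e
    against it gives the mu-integral of e / f divided by q, and w is almost
    everywhere positive, which gives mutual absolute continuity. *)
Lemma numeraire_dual_measure f : numeraire H mu f -> exists P, dual_measure f P.
Proof.
move=> fN; have [fH fle] := fN; have [mf f0 _] := fH.
have [q qE] := finite_measureT_EFin mu.
have q0 : (0 < q)%R by rewrite -lte_fin -qE.
pose w x := (q^-1)%:E * (f x)^-1.
have w0 x : 0 <= w x by rewrite mule_ge0 ?inve_ge0// lee_fin invr_ge0 ltW.
have mw : measurable_fun [set: X] w.
  by apply: emeasurable_funM => //; exact: ge0_measurable_inve.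
have ew e : evalues H e -> \int[mu]_x (e x * w x) <= 1.
  move=> eH; have [me e0 _] := eH.
  under eq_integral do rewrite muleCA.
  rewrite ge0_integralZl_EFin//; last 3 first.
  - by move=> x _; exact: evalue_ratio_ge0 eH fH.
  - exact: measurable_evalue_ratio eH fH.
  - by rewrite invr_ge0 ltW.
  apply: le_trans (_ : (q^-1)%:E * q%:E <= _).
    by apply: lee_wpmul2l; [rewrite lee_fin invr_ge0 ltW|rewrite -qE fle].
  by rewrite -EFinM mulVf ?gt_eqF.
have wint : mu.-integrable [set: X] w.
  apply/integrableP; split => //; under eq_integral do rewrite gee0_abs//.
  apply: le_lt_trans (ltry 1).
  by under eq_integral do rewrite -[w _]mul1e; exact: ew (evalue_cst1 H).
have fpos := numeraire_gt0 fN.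
have rae : {ae mu, forall x, exists2 a : R, (0 < a)%R & f x = a%:E}.
  apply: filterS (evalues_real_ae mu_ac fH fH fpos) => x [a [b [a0 _ fE _]]].
  by exists a.
pose P : {finite_measure set X -> \bar R} := density w0 wint.
have PE g : (forall x, 0 <= g x) -> measurable_fun [set: X] g ->
  \int[P]_x g x = \int[mu]_x (g x * w x) by exact: ge0_integral_density.
have Pmu : P `<< mu by exact: dominates_density.
have muP : mu `<< P.
  apply: density_dominates; apply: filterS rae => x [a a0 fE].
  by rewrite /w fE inver gt_eqF// -EFinM lte_fin mulr_gt0 ?invr_gt0.
have qfE : {ae mu, forall x, q%:E * f x * w x = 1}.
  apply: filterS rae => x [a a0 fE].
  rewrite /w fE inver gt_eqF// -!EFinM; congr EFin.
  by field; rewrite !gt_eqF.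
exists P; split => //.
- by move=> e eH; rewrite PE; [exact: ew|case: eH|case: eH].
- have : ae_eq P [set: X] ('d (charge_of_finite_measure mu) '/d P)
      (fun x => q%:E * f x).
    apply: integral_ae_eq => //.
    + exact: Radon_Nikodym_integrable.
    + exact: emeasurable_funM.
    move=> A _ mA; rewrite -Radon_Nikodym_integral//.
    rewrite [RHS]integral_mkcond PE; last 2 first.
    + move=> x; rewrite patchE; case: ifP => // _.
      by rewrite mule_ge0// lee_fin ltW.
    + apply/(measurable_restrictT _ mA); apply: measurable_funTS.
      exact: emeasurable_funM.
    rewrite [LHS](_ : _ = \int[mu]_(x in A) cst 1 x); last first.
      by rewrite integral_cst// mul1e.
    rewrite integral_mkcond; apply: ae_eq_integral => //.
    + by apply/(measurable_restrictT _ mA).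
    + apply: emeasurable_funM => //.
      apply/(measurable_restrictT _ mA); apply: measurable_funTS.
      exact: emeasurable_funM.
    apply: filterS qfE => x xE _; rewrite !patchE; case: ifP => _.
      by rewrite xE.
    by rewrite mul0e.
  move=> /(ae_dominates muP); apply: filterS => x /(_ I) ->.
  rewrite qE inver gt_eqF// muleA -EFinM mulVf ?gt_eqF// mul1e//.
- rewrite PE// (_ : \int[mu]_x _ = \int[mu]_x (cst (q^-1)%:E) x).
    rewrite integral_cst// [X in _ * X]qE -EFinM mulVf// gt_eqF//.
  apply: ae_eq_integral => //; first exact: emeasurable_funM.
  apply: filterS rae => x [a a0 fE] _.
  rewrite /w fE inver gt_eqF// -!EFinM; congr EFin.
  by field; rewrite !gt_eqF.
Qed.

End duality.

(** * Boundedness of e-values in measure *)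

Section bounded_in_measure.
Context (d : measure_display) (X : measurableType d) (R : realType).
Variables (H : set (probability X R)) (mu : {finite_measure set X -> \bar R}).
Hypothesis mu_ac : forall A, H_negligible H A -> mu A = 0.

(** If the claim fails for eta, pick e-values e_n exceeding 2 ^ (n + 1) on a set of
    measure more than eta.  On the limit superior of these sets, which has measure
    at least eta, the e-value sum of 2 ^ - (n + 1) e_n has infinitely many terms
    above 1, so it is infinite. *)
Lemma evalues_bounded_in_measure (eta : R) : (0 < eta)%R ->
  exists N : nat, forall e, evalues H e ->
    mu [set x | N%:R%:E < e x] <= eta%:E.
Proof.
move=> eta0; apply: contrapT => /forallNP unb.
have /choice[e eP] : forall n, exists e, evalues H e /\
    eta%:E < mu [set x | (2 ^ n.+1)%N%:R%:E < e x].
  move=> n; have /existsNP[e] := unb (2 ^ n.+1)%N.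
  by move=> /not_implyP[eH /negP]; rewrite -ltNge => ?; exists e.
have eH n : evalues H (e n) by case: (eP n).
have me n : measurable_fun [set: X] (e n) by case: (eH n).
have e0 n x : 0 <= e n x by case: (eH n).
pose A n := [set x | (2 ^ n.+1)%N%:R%:E < e n x].
have mA n : measurable (A n).
  by rewrite -[A n]setTI; exact: emeasurable_fun_o_infty.
have mUA n : measurable (\bigcup_(k in [set k | (n <= k)%N]) A k).
  exact: bigcup_measurable.
have limA : mu (lim_sup_set A) = 0.
  apply: measure_negligible.
    by apply: bigcap_measurable => //; exists 0%N.
  have := evalue_lty mu_ac (evalue_series eH).
  apply: negligibleS => x xA /= soo.
  have := nneseries_tail_cvg soo.
  have ce0 n : 0 <= (1 / (2 ^ n.+1)%:R)%:E * e n x.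
    by rewrite mule_ge0// lee_fin divr_ge0.
  move=> /(_ (fun n _ => ce0 n)) /fine_cvgP[tfin /cvgr0Pnorm_lt/(_ _ ltr01) t1].
  near \oo => n.
  have tailfin : \sum_(n <= k <oo) ((1 / (2 ^ k.+1)%:R)%:E * e k x) \is a fin_num.
    by near: n.
  have : (`|fine (\sum_(n <= k <oo) ((1 / (2 ^ k.+1)%:R)%:E * e k x))%E| < 1)%R.
    by near: n.
  have [k /= nk Akx] := xA n I.
  apply/negP; rewrite -leNgt ger0_norm ?fine_ge0 ?nneseries_ge0//.
  rewrite -lee_fin fineK//.
  apply: le_trans (nneseries_lim_ge k.+1 _) => //.
  rewrite big_nat_recr//=; apply: le_trans (_ : _ <= (1 / (2 ^ k.+1)%:R)%:E * e k x) _.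
    have -> : 1 = (1 / (2 ^ k.+1)%:R)%:E * (2 ^ k.+1)%N%:R%:E :> \bar R.
      by rewrite -EFinM divfK// pnatr_eq0 expn_eq0.
    by rewrite lee_wpmul2l ?lee_fin ?divr_ge0// ltW.
  by rewrite leeDr// sume_ge0.
have mufin : mu (\bigcup_(k in [set k | (0 <= k)%N]) A k) < +oo.
  by rewrite ltey_eq fin_num_measure.
have cvgA := lim_sup_set_cvg mu A mA mufin.
have : eta%:E <= mu (lim_sup_set A).
  rewrite -(cvg_lim _ cvgA)//; apply: lime_ge.
    by apply/cvg_ex; eexists; exact: cvgA.
  apply: nearW => n; case: (eP n) => _ /ltW /le_trans; apply.
  apply: le_measure; rewrite ?inE//; first exact: mA.
  by move=> x Ax; exists n => /=.
by rewrite limA lee_fin leNgt eta0.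
Unshelve. all: by end_near. Qed.

End bounded_in_measure.

(** * Near-maximizers of the expected logarithm among bounded e-values *)

Section bounded_evalues.
Context (d : measure_display) (X : measurableType d) (R : realType).
Variables (H : set (probability X R)) (mu : {finite_measure set X -> \bar R}).
Implicit Types (N M : R) (f g : X -> R) (e : X -> \bar R).

(** Bounds on both sides make the logarithm bounded, hence integrable. *)
Definition bounded_evalue N f :=
  [/\ measurable_fun [set: X] f, forall x, (N^-1 <= f x <= N)%R
    & evalues H (EFin \o f)].

Definition expected_log f : R := (\int[mu]_x ln (f x))%R.

Lemma bounded_evalue_gt0 N f x : (0 < N)%R -> bounded_evalue N f -> (0 < f x)%R.
Proof.
move=> N0 [_ /(_ x)/andP[Nf _] _]; apply: lt_le_trans Nf.
by rewrite invr_gt0.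
Qed.

Lemma bounded_evalue_monotone N M f : (0 < N)%R -> (N <= M)%R ->
  bounded_evalue N f -> bounded_evalue M f.
Proof.
move=> N0 NM [mf fb fH]; split => // x; have /andP[Nf fN] := fb x.
rewrite (le_trans fN NM) andbT; apply: le_trans Nf.
by rewrite lef_pV2// posrE// (lt_le_trans N0).
Qed.

Lemma bounded_evalue_cst1 N : (1 <= N)%R -> bounded_evalue N (cst 1%R).
Proof.
move=> N1; split => //; last exact: evalue_cst1.
by move=> x /=; rewrite N1 invf_le1 ?N1// (lt_le_trans ltr01).
Qed.

Lemma bounded_evalue_convex N (t : R) f g : (0 <= t <= 1)%R ->
  bounded_evalue N f -> bounded_evalue N g ->
  bounded_evalue N (fun x => (1 - t) * f x + t * g x)%R.
Proof.
move=> t01 [mf fb fH] [mg gb gH]; split.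
- by apply: measurable_funD; apply: measurable_funM.
- move=> x; have /andP[? ?] := fb x; have /andP[? ?] := gb x.
  by move: t01 => /andP[? ?]; apply/andP; split; nra.
- exact: evalue_convex t01 gH fH.
Qed.

(** Truncating e at N keeps it an e-value; the small multiple of the e-value 1 then
    restores the lower bound. *)
Definition bounded_part N e x : R :=
  ((1 - N^-1) * fine (mine (e x) N%:E) + N^-1 * 1)%R.

Lemma bounded_part_bounded N e : (1 <= N)%R -> evalues H e ->
  bounded_evalue N (bounded_part N e).
Proof.
move=> N1 eH; have [me e0 _] := eH; have N0 : (0 < N)%R by lra.
have d0 : (0 < N^-1)%R by rewrite invr_gt0.
have d1 : (N^-1 <= 1)%R by rewrite invf_le1.
have mm : measurable_fun [set: X] (fun x => mine (e x) N%:E).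
  exact: measurable_mine.
have m0 x : 0 <= mine (e x) N%:E by rewrite le_min e0 lee_fin ltW.
have mN x : mine (e x) N%:E <= N%:E by rewrite ge_min lexx orbT.
have mfin x : mine (e x) N%:E \is a fin_num.
  by rewrite ge0_fin_numE//; apply: le_lt_trans (mN x) (ltry _).
split.
- apply: measurable_funD => //; apply: measurable_funM => //.
  exact: measurableT_comp.
- move=> x; rewrite /bounded_part; set m := fine _.
  have m0' : (0 <= m)%R by exact: fine_ge0.
  have mN' : (m <= N)%R by rewrite -lee_fin fineK.
  by apply/andP; split; nra.
- have mH : evalues H (fun x => mine (e x) N%:E).
    by apply: evalue_le eH _ _ _ => // x; rewrite ge_min lexx.
  have d01 : (0 <= N^-1 <= 1)%R by rewrite d1 ltW.
  have := evalue_convex d01 (evalue_cst1 H) mH.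
  congr (evalues H _); apply/funext => x /=.
  by rewrite -{1}(fineK (mfin x)) -!EFinM -EFinD.
Qed.

Lemma expected_log_integrable N f : (0 < N)%R -> bounded_evalue N f ->
  mu.-integrable [set: X] (EFin \o (@ln R \o f)).
Proof.
move=> N0 fN; have [mf fb _] := fN.
apply: (le_integrable measurableT (g := cst (ln N)%:E)).
- by apply/measurable_EFinP; apply: measurableT_comp.
- move=> x _ /=; have /andP[Nf fx] := fb x.
  have f0 := bounded_evalue_gt0 x N0 fN.
  have ub : (ln (f x) <= ln N)%R by rewrite ler_ln ?posrE.
  have lb : (- ln N <= ln (f x))%R.
    by rewrite -lnV ?posrE// ler_ln ?posrE ?invr_gt0.
  by rewrite lee_fin (le_trans _ (ler_norm _))// ler_norml lb ub.
- exact: finite_measure_integrable_cst.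
Qed.

Lemma expected_log_near_max N (eps : R) : (1 <= N)%R -> (0 < eps)%R ->
  exists f, bounded_evalue N f /\ forall g, bounded_evalue N g ->
    (expected_log g <= expected_log f + eps)%R.
Proof.
move=> N1 eps0; have N0 : (0 < N)%R by lra.
pose V : set R := [set expected_log f | f in bounded_evalue N].
have Vub : ubound V (fine (mu [set: X]) * ln N)%R.
  move=> _ [f fN <-]; rewrite mulrC -Rintegral_cst//.
  apply: le_Rintegral => //; first exact: expected_log_integrable fN.
    exact: finite_measure_integrable_cst.
  move=> x _; have [_ /(_ x)/andP[_ fx] _] := fN.
  by rewrite ler_ln ?posrE//; exact: bounded_evalue_gt0 fN.
have Vsup : has_sup V.
  split; last by eexists; exact: Vub.
  by exists (expected_log (cst 1%R)), (cst 1%R) => //; exact: bounded_evalue_cst1.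
have [_ [f fN <-] fsup] := sup_adherent eps0 Vsup.
exists f; split => // g gN; rewrite -lerBlDr (le_trans _ (ltW fsup))// lerD2r.
by apply: ub_le_sup; [case: Vsup|exists g].
Qed.

(** Quantitative strict concavity of ln at the midpoint h of a and b, where the
    comparison with a uses h cut down to the bounds of a.  Put
    s = |a - b| / (a + b).  If b <= N the truncation is inactive, and
    ln (h^2 / (a b)) >= 1 - a b / h^2 = s^2.  If N < b, then ln (h / b) >= -1
    since h >= b / 2, and the truncated midpoint still exceeds a; as s <= 1 the
    term 2 compensates for the loss.  Mixing in the constant 1 with weight del
    costs at most 2 del.  Finally s <= s^2 / r + r. *)
Lemma log_gain (N r a b del h k : R) : (0 < r)%R -> (0 < a <= N)%R -> (0 < b)%R ->
  (0 < del <= 1 / 2)%R ->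
  h = ((1 - 1 / 2) * a + 1 / 2 * b)%R ->
  k = ((1 - del) * Num.min h N + del * 1)%R ->
  (`|a - b| / (a + b) <= r^-1 * ((ln h - ln b) + (ln k - ln a) +
    (2 * del + 2 * (N < b)%R%:R)) + r)%R.
Proof.
move=> r0 /andP[a0 aN] b0 /andP[d0 d1] hE kE.
have ab0 : (0 < a + b)%R by rewrite addr_gt0.
have h0 : (0 < h)%R by rewrite hE; lra.
have N0 : (0 < N)%R by exact: lt_le_trans aN.
set s := (`|a - b| / (a + b))%R.
have s0 : (0 <= s)%R by rewrite divr_ge0// ltW.
have s1 : (s <= 1)%R.
  by rewrite ler_pdivrMr// mul1r ler_norml; apply/andP; split; lra.
set m := Num.min h N; have m0 : (0 < m)%R by rewrite lt_min h0 N0.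
have lnk : (ln m - 2 * del <= ln k)%R.
  have dm0 : (0 < (1 - del) * m)%R by apply: mulr_gt0 => //; lra.
  have : (ln ((1 - del) * m) <= ln k)%R.
    by rewrite ler_ln ?posrE// kE -/m mulr1; lra.
  rewrite lnM ?posrE//; last lra.
  have dd0 : (0 < 1 - del)%R by lra.
  have := ln_ge1BV dd0; have : ((1 - del)^-1 <= 1 + 2 * del)%R.
    by rewrite -[leLHS]mul1r ler_pdivrMr//; nra.
  lra.
have key : (s ^+ 2 <= (ln h - ln b) + (ln k - ln a) + (2 * del + 2 * (N < b)%R%:R))%R.
  have [bN|Nb] /= := leP b N.
    have mh : m = h by apply/min_idPl; rewrite hE; lra.
    have -> : (s ^+ 2 = 1 - (h / b * (h / a))^-1)%R.
      rewrite /s expr_div_n real_normK ?num_real// hE.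
      by field; rewrite !gt_eqF//; lra.
    have := @ln_ge1BV R (h / b * (h / a)) _.
    rewrite lnM ?posrE ?divr_gt0// !ln_div ?posrE//.
    by rewrite mulr_gt0 ?divr_gt0// => /(_ isT); rewrite mh in lnk; lra.
  have ma : (a <= m)%R by rewrite le_min aN andbT hE; lra.
  have lnam : (ln a <= ln m)%R by rewrite ler_ln ?posrE.
  have : (s ^+ 2 <= 1)%R by rewrite expr_le1.
  have := @ln_ge1BV R (h / b) (divr_gt0 h0 b0).
  rewrite ln_div ?posrE// invf_div.
  have : (b / h <= 2)%R by rewrite ler_pdivrMr// hE; lra.
  lra.
apply: le_trans (_ : _ <= r^-1 * s ^+ 2 + r)%R _; last first.
  by rewrite lerD2r ler_wpM2l// invr_ge0 ltW.
have -> : (r^-1 * s ^+ 2 + r = (s ^+ 2 + r ^+ 2) / r)%R by field; rewrite gt_eqF.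
by rewrite ler_pdivlMr//; nra.
Qed.

(** Integrates log_gain.  The midpoint competes with g, and its truncation competes
    with f, so both expected gains are at most r ^ 2; so are 1 / N and the measure
    of the set where g exceeds N, and the division by r in log_gain leaves a bound
    of order r. *)
Lemma near_maximizers_close N M (r : R) f g :
  (2 <= N)%R -> (N <= M)%R -> (0 < r)%R -> (N^-1 <= r ^+ 2)%R ->
  mu [set x | N%:E < (g x)%:E] <= (r ^+ 2)%:E ->
  bounded_evalue N f -> bounded_evalue M g ->
  (forall h, bounded_evalue N h -> expected_log h <= expected_log f + r ^+ 2)%R ->
  (forall h, bounded_evalue M h -> expected_log h <= expected_log g + r ^+ 2)%R ->
  \int[mu]_x (`|f x - g x| / (f x + g x))%:E <=
    ((4 + 3 * fine (mu [set: X])) * r)%:E.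
Proof.
move=> N2 NM r0 Nr muB fN gM fmax gmax.
have N0 : (0 < N)%R by lra. have M0 : (0 < M)%R by lra.
have fM := bounded_evalue_monotone N0 NM fN.
have f0 x := bounded_evalue_gt0 x N0 fN.
have g0 x := bounded_evalue_gt0 x M0 gM.
have [mf fb fH] := fN; have [mg gb gH] := gM.
pose h x := ((1 - 1 / 2) * f x + 1 / 2 * g x)%R.
have hM : bounded_evalue M h by apply: bounded_evalue_convex => //; lra.
have [mh _ hH] := hM.
pose k := bounded_part N (EFin \o h).
have kN : bounded_evalue N k by apply: bounded_part_bounded => //; lra.
have [mk _ _] := kN.
pose B := [set x | N%:E < (g x)%:E].
have mB : measurable B.
  rewrite -[B]setTI; apply: emeasurable_fun_o_infty => //.
  exact/measurable_EFinP.
pose G x := (r^-1 * ((ln (h x) - ln (g x)) + (ln (k x) - ln (f x)) +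
  (2 * N^-1 + 2 * \1_B x)) + r)%R.
have i1 := expected_log_integrable M0 hM.
have i2 := expected_log_integrable M0 gM.
have i3 := expected_log_integrable N0 kN.
have i4 := expected_log_integrable N0 fN.
have i5 : mu.-integrable [set: X] (EFin \o \1_B) by exact: integrable_indic.
have ic c : mu.-integrable [set: X] (EFin \o cst c).
  exact: finite_measure_integrable_cst.
have iZ c (u : X -> R) : mu.-integrable [set: X] (EFin \o u) ->
    mu.-integrable [set: X] (EFin \o (fun x => c * u x)%R).
  by move=> iu; exact: (integrableZl measurableT c iu).
have iD (u v : X -> R) : mu.-integrable [set: X] (EFin \o u) ->
    mu.-integrable [set: X] (EFin \o v) ->
    mu.-integrable [set: X] (EFin \o (fun x => u x + v x)%R).
  by move=> iu iv; exact: (integrableD measurableT iu iv).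
have iB (u v : X -> R) : mu.-integrable [set: X] (EFin \o u) ->
    mu.-integrable [set: X] (EFin \o v) ->
    mu.-integrable [set: X] (EFin \o (fun x => u x - v x)%R).
  by move=> iu iv; exact: (integrableB measurableT iu iv).
have i12 := iB _ _ i1 i2; have i34 := iB _ _ i3 i4.
have i1234 := iD _ _ i12 i34.
have iZ5 := iZ 2%R _ i5.
have ic5 := iD _ _ (ic (2 * N^-1)%R) iZ5.
have iS := iD _ _ i1234 ic5.
have iG : mu.-integrable [set: X] (EFin \o G) := iD _ _ (iZ r^-1%R _ iS) (ic r).
have leG : \int[mu]_x (`|f x - g x| / (f x + g x))%:E <= \int[mu]_x (G x)%:E.
  apply: ge0_le_integral => //.
  - by move=> x _; rewrite lee_fin divr_ge0// ltW// addr_gt0.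
  - exact: measurable_reldiff.
  - exact: measurable_int iG.
  - move=> x _; rewrite lee_fin.
    rewrite /G indicE (_ : (x \in B) = (N < g x)%R); last first.
      by apply/idP/idP; rewrite inE /B/= lte_fin.
    apply: log_gain => //.
    + by rewrite f0; have /andP[] := fb x.
    + by rewrite invr_gt0 N0/= mul1r lef_pV2 ?posrE.
    + by rewrite /k /bounded_part /= -EFin_min.
apply: le_trans leG _.
rewrite -[leLHS]fineK; last exact: integrable_fin_num.
rewrite lee_fin -/(Rintegral mu setT G).
have -> : (\int[mu]_x G x = r^-1 * ((expected_log h - expected_log g) +
   (expected_log k - expected_log f) + (2 * N^-1 * fine (mu [set: X]) +
   2 * fine (mu B))) + r * fine (mu [set: X]))%R.
  rewrite /G (RintegralD measurableT (iZ _ _ iS) (ic r)).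
  rewrite (RintegralZl _ measurableT iS) (RintegralD measurableT i1234 ic5).
  rewrite (RintegralD measurableT i12 i34) (RintegralB measurableT i1 i2).
  rewrite (RintegralB measurableT i3 i4) (RintegralD measurableT (ic _) iZ5).
  rewrite (RintegralZl _ measurableT i5) !Rintegral_cst//.
  by rewrite /Rintegral integral_indic// setIT.
have hg := gmax _ hM; have kf := fmax _ kN.
set q := fine (mu [set: X]); have q0 : (0 <= q)%R by exact: fine_ge0.
have muB' : (fine (mu B) <= r ^+ 2)%R.
  by rewrite -lee_fin fineK ?fin_num_measure.
have Nq : (N^-1 * q <= r ^+ 2 * q)%R by rewrite ler_wpM2r.
set S := ((expected_log h - _) + _ + _)%R.
have Sle : (S <= (4 + 2 * q) * r ^+ 2)%R by rewrite /S; nra.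
have -> : (r^-1 * S + r * q = (S + r ^+ 2 * q) / r)%R by field; rewrite gt_eqF.
by rewrite ler_pdivrMr//; nra.
Qed.

End bounded_evalues.

(** * Existence of a numeraire *)

Section dyadic.
Context (R : realType).

(** These numbers bound, up to a constant, the distance between consecutive
    near-maximizers, and serve as mixing weights in the limit; their squares are the
    errors of the maximization. *)
Definition dyadic n : R := (1 / (2 ^ n.+1)%:R)%R.

Lemma dyadic_gt0 n : (0 < dyadic n)%R.
Proof. by rewrite divr_gt0// ltr0n expn_gt0. Qed.

Lemma dyadic_lt1 n : (dyadic n < 1)%R.
Proof.
rewrite /dyadic div1r invf_lt1 ?ltr1n ?ltr0n ?expn_gt0//.
by rewrite -[1%N](expn0 2) ltn_exp2l.
Qed.

Lemma cvg_dyadic : dyadic n @[n --> \oo] --> 0%R.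
Proof.
apply: (@squeeze_cvgr _ _ _ _ (cst 0%R) (@harmonic R)); last 2 first.
- exact: cvg_cst.
- exact: cvg_harmonic.
apply: nearW => n; rewrite ltW ?dyadic_gt0//=.
rewrite /dyadic div1r lef_pV2 ?posrE ?ltr0n ?expn_gt0//.
by rewrite ler_nat ltnW// ltn_expl.
Qed.

End dyadic.
Arguments dyadic {R} n.
Arguments dyadic_gt0 {R} n.
Arguments dyadic_lt1 {R} n.
Arguments cvg_dyadic {R}.

Section existence.
Context (d : measure_display) (X : measurableType d) (R : realType).
Variables (H : set (probability X R)) (mu : {finite_measure set X -> \bar R}).
Hypothesis mu_ac : forall A, H_negligible H A -> mu A = 0.
Implicit Types (e z : X -> \bar R).

Let r (n : nat) : R := dyadic n.
Let r_gt0 n : (0 < r n)%R := dyadic_gt0 n.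
Let r_lt1 n : (r n < 1)%R := dyadic_lt1 n.
Let cvg_r : r n @[n --> \oo] --> 0%R := cvg_dyadic.

Definition near_maximizing (N : R^nat) (f : nat -> X -> R) :=
  [/\ forall n, (2 <= N n)%R /\ ((N n)^-1 <= dyadic n ^+ 2)%R,
      forall n, bounded_evalue H (N n) (f n),
      forall n g, bounded_evalue H (N n) g ->
        (expected_log mu g <= expected_log mu (f n) + dyadic n ^+ 2)%R
    & \sum_(n <oo) \int[mu]_x (`|f n x - f n.+1 x| / (f n x + f n.+1 x))%:E
      < +oo].

(** Beyond near-maximality, N_n has to exceed a level that all e-values pass only on
    a set of measure at most dyadic n ^ 2; near_maximizers_close then applies. *)
Lemma near_maximizing_exists : exists N f, near_maximizing N f.
Proof.
have r20 n : (0 < r n ^+ 2)%R by rewrite exprn_gt0.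
have [K KP] := choice (fun n => evalues_bounded_in_measure mu_ac (r20 n)).
(* summing makes the bounds increase; 4 ^ (n + 1) is the inverse of r_n ^ 2 *)
pose N n : R := (\sum_(i < n.+1) (K i + 4 ^ i.+1))%N%:R.
have N4 n : (4 ^+ n.+1 <= N n)%R.
  rewrite -natrX ler_nat big_ord_recr/=.
  by rewrite (leq_trans _ (leq_addl _ _))// leq_addl.
have NK n : ((K n)%:R <= N n)%R.
  rewrite ler_nat big_ord_recr/=.
  by rewrite (leq_trans _ (leq_addl _ _))// leq_addr.
have NS n : (N n <= N n.+1)%R.
  by rewrite ler_nat [leqRHS]big_ord_recr/= leq_addr.
have N2 n : (2 <= N n)%R.
  apply: le_trans (N4 n); rewrite exprS.
  have : (1 <= 4 ^+ n :> R)%R by rewrite exprn_ege1// ler1n.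
  lra.
have N0 n : (0 < N n)%R by have := N2 n; lra.
have Nr n : ((N n)^-1 <= r n ^+ 2)%R.
  rewrite /r /dyadic div1r exprVn -natrX -expnM mulnC expnM natrX.
  by rewrite lef_pV2 ?posrE ?exprn_gt0 ?N4// ltr0n.
have N1 n : (1 <= N n)%R by have := N2 n; lra.
have [f fP] := choice (fun n => expected_log_near_max H mu (N1 n) (r20 n)).
exists N, f; split.
- by move=> n; split.
- by move=> n; case: (fP n).
- by move=> n; case: (fP n).
have muE q : (0 <= fine (mu q))%R by exact: fine_ge0.
apply: le_lt_trans (_ : \sum_(n <oo)
    ((4 + 3 * fine (mu [set: X])) / (2 ^ n.+1)%:R)%:E < +oo).
  apply: lee_nneseries => [n _ _|n _].
    apply: integral_ge0 => x _; rewrite lee_fin divr_ge0// addr_ge0// ltW//.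
      by apply: bounded_evalue_gt0 (N0 _) (fP _).1.
    by apply: bounded_evalue_gt0 (N0 _) (fP _).1.
  rewrite -[X in (X / _)%:E]mulr1 -mulrA.
  apply: near_maximizers_close (N2 n) (NS n) (r_gt0 n) (Nr n) _
    (fP n).1 (fP n.+1).1 (fP n).2 _.
  - have [_ _ fH] := (fP n.+1).1.
    apply: le_trans (KP n _ fH); apply: le_measure; rewrite ?inE.
    + rewrite -[X in measurable X]setTI; apply: emeasurable_fun_o_infty => //.
      by case: fH.
    + rewrite -[X in measurable X]setTI; apply: emeasurable_fun_o_infty => //.
      by case: fH.
    + by move=> x /=; apply: le_lt_trans; rewrite lee_fin.
  - move=> h /(fP n.+1).2 /le_trans; apply; rewrite lerD2l.
    rewrite lerXn2r ?nnegrE ?(ltW (r_gt0 _))// /r /dyadic !div1r.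
    rewrite lef_pV2 ?posrE ?ltr0n ?expn_gt0//.
    by rewrite ler_nat leq_exp2l.
apply: le_lt_trans (epsilon_trick0 _ _) _; last exact: ltry.
by have := muE setT; lra.
Qed.

Section limit.
Variables (N : R^nat) (f : nat -> X -> R).
Hypothesis Nf : near_maximizing N f.

Let Nr n : ((N n)^-1 <= r n ^+ 2)%R.
Proof. by have [/(_ n)[]] := Nf. Qed.

Let N1 n : (1 <= N n)%R.
Proof. by have [/(_ n)[? _] _ _ _] := Nf; lra. Qed.

Let N0 n : (0 < N n)%R.
Proof. by have := N1 n; lra. Qed.

Let fN n : bounded_evalue H (N n) (f n).
Proof. by have [_ /(_ n)] := Nf. Qed.

Let fmax n g : bounded_evalue H (N n) g ->
  (expected_log mu g <= expected_log mu (f n) + r n ^+ 2)%R.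
Proof. by have [_ _ /(_ n g)] := Nf. Qed.

Let fsum : \sum_(n <oo)
  \int[mu]_x (`|f n x - f n.+1 x| / (f n x + f n.+1 x))%:E < +oo.
Proof. by have [] := Nf. Qed.

Let fpos n x : (0 < f n x)%R.
Proof. exact: bounded_evalue_gt0 (N0 n) (fN n). Qed.

Let fH n : evalues H (EFin \o f n).
Proof. by case: (fN n). Qed.

Let g x := limn_einf (fun n => (f n x)%:E).

Lemma near_maximizing_limit : evalues H g.
Proof. exact: evalue_limn_einf. Qed.

Let gH := near_maximizing_limit.

(** The relative increments are almost everywhere summable, so f_n has a limit in
    [0, +oo]; the limit is finite because g is an e-value. *)
Lemma near_maximizing_cvg : {ae mu, forall x, exists a : R,
  [/\ (0 <= a)%R, g x = a%:E & f n x @[n --> \oo] --> a]}.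
Proof.
pose s n x := (`|f n x - f n.+1 x| / (f n x + f n.+1 x))%R.
have s0 n x : 0 <= (s n x)%:E.
  by rewrite lee_fin divr_ge0// addr_ge0 ?ltW.
have ms n : measurable_fun [set: X] (fun x => (s n x)%:E).
  have mf k : measurable_fun [set: X] (f k) by case: (fN k).
  exact: measurable_reldiff (mf n) (mf n.+1) (fpos n) (fpos n.+1).
have S0 x : 0 <= \sum_(n <oo) (s n x)%:E by exact: nneseries_ge0.
have Sint : mu.-integrable [set: X] (fun x => \sum_(n <oo) (s n x)%:E).
  apply/integrableP; split; first exact: ge0_emeasurable_sum.
  by under eq_integral do rewrite gee0_abs//; rewrite integral_nneseries.
move: (evalue_lty mu_ac gH) (integrable_ae measurableT Sint).
apply: filterS2 => x goo /(_ I); rewrite ge0_fin_numE// => /cvg_of_summable_reldiff.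
case=> [n|[a a0 fa]|fy]; first exact: fpos.
  exists a; split => //.
  rewrite /g (cvg_limn_einf_sup (_ : _ --> a%:E)).1//.
  by apply: cvg_EFin fa; exact: nearW.
move: goo; rewrite /g (cvg_limn_einf_sup (_ : _ --> +oo)).1//.
exact/cvgeryP.
Qed.

Let e_ e n := bounded_part (N n) e.

Let eN e : evalues H e -> forall n, bounded_evalue H (N n) (e_ e n).
Proof. by move=> eH n; exact: bounded_part_bounded. Qed.

(** The ratios that first_order bounds for f_n and the bounded part of e. *)
Let y e n x :=
  (e_ e n x)%:E / ((1 - r n)%:E * (f n x)%:E + (r n)%:E * (e_ e n x)%:E).

Let r01 n : (0 < r n < 1)%R.
Proof. by rewrite r_gt0 r_lt1. Qed.

Let r01' n : (0 <= r n <= 1)%R.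
Proof. by rewrite !ltW. Qed.

Let ftH e : evalues H e -> forall n, evalues H
  (fun x => (1 - r n)%:E * (f n x)%:E + (r n)%:E * (e_ e n x)%:E).
Proof.
move=> eH n; have [_ _ ?] := eN eH n.
exact: (@evalue_convex _ _ _ H (r n) (EFin \o e_ e n) (EFin \o f n)).
Qed.

Let yE e n x : evalues H e ->
  y e n x = (e_ e n x / ((1 - r n) * f n x + r n * e_ e n x))%:E.
Proof.
move=> eH; rewrite /y -!EFinM -EFinD inver gt_eqF -?EFinM//.
have := fpos n x; have := bounded_evalue_gt0 x (N0 n) (eN eH n).
by have /andP[? ?] := r01 n; nra.
Qed.

Let yle e : evalues H e ->
  forall n, \int[mu]_x y e n x <= mu [set: X] + (r n)%:E.
Proof.
move=> eH n; have eNn := eN eH n; have [_ _ enH] := eNn.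
apply: le_trans (first_order mu_ac (r01 n) enH (fH n) _ (eps := (r n ^+ 2)%R) _) _.
- by apply: aeW => x; rewrite lte_fin.
- pose ft x := ((1 - r n) * f n x + r n * e_ e n x)%R.
  have ftN : bounded_evalue H (N n) ft by exact: bounded_evalue_convex.
  have -> : \int[mu]_x (lne ((EFin \o f n) x) -
      lne ((1 - r n)%:E * (EFin \o f n) x + (r n)%:E * (EFin \o e_ e n) x)) =
      (expected_log mu (f n) - expected_log mu ft)%:E.
    have i1 := expected_log_integrable mu (N0 n) (fN n).
    have i2 := expected_log_integrable mu (N0 n) ftN.
    rewrite -(RintegralB measurableT i1 i2) /Rintegral fineK; last first.
      by apply: integrable_fin_num => //; exact: (integrableB measurableT i1 i2).
    apply: eq_integral => x _.
    rewrite [LHS](_ : _ = lne (f n x)%:E - lne (ft x)%:E)// !lne_EFin//.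
    exact: bounded_evalue_gt0 (N0 n) ftN.
  by rewrite lee_fin; have := fmax ftN; lra.
- rewrite leeD2l// lee_fin.
  have -> : (r n ^+ 2 * ((1 - r n) / r n) = r n - r n ^+ 2)%R.
    by field; rewrite gt_eqF.
  by rewrite gerBl sqr_ge0.
Qed.

(** The weights r_n dominate the errors r_n ^ 2 of the near-maximizers, so the error
    term of first_order vanishes in the limit. *)
Let limle e z : evalues H e -> measurable_fun [set: X] z ->
  (forall x, 0 <= z x) -> {ae mu, forall x, z x <= limn_einf (fun n => y e n x)} ->
  \int[mu]_x z x <= mu [set: X].
Proof.
move=> eH mz z0 zy.
have cvgq : mu [set: X] + (r n)%:E @[n --> \oo] --> mu [set: X].
  rewrite -[X in _ --> X]adde0; apply: cvgeD; [|exact: cvg_cst|].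
    by rewrite fin_num_adde_defr// fin_num_measure.
  by apply: cvg_EFin; [exact: nearW|exact: cvg_r].
have enH n : evalues H (EFin \o e_ e n).
  by case: (eN eH n).
apply: (fatou_le _ _ mz z0 zy (yle eH) cvgq) => n.
  exact: measurable_evalue_ratio (enH n) (ftH eH n).
by move=> x; exact: evalue_ratio_ge0 (enH n) (ftH eH n).
Qed.

(** Taking e = 1 bounds the integral of 1 / g, where 1 / 0 is infinite: at a point
    where f_n tends to 0, the ratios of first_order tend to infinity. *)
Lemma near_maximizing_limit_gt0 : {ae mu, forall x, 0 < g x}.
Proof.
have [mg g0 _] := gH.
have c1H := evalue_cst1 H.
have ginv : mu.-integrable [set: X] (fun x => (g x)^-1).
  apply/integrableP; split; first exact: ge0_measurable_inve.
  under eq_integral do rewrite gee0_abs ?inve_ge0//.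
  apply: le_lt_trans (limle c1H _ _ _) _.
  - exact: ge0_measurable_inve.
  - by move=> x; rewrite inve_ge0.
  - apply: filterS near_maximizing_cvg => x [a [a0 -> fa]].
    have e1 n : e_ (cst 1) n x = 1%R.
      rewrite /e_ /bounded_part /= -EFin_min/=.
      by rewrite (min_idPl _) ?N1//; ring.
    under eq_fun do rewrite yE// e1 mulr1 div1r.
    have fta : ((1 - r n) * f n x + r n)%R @[n --> \oo] --> a.
      have -> : (a = (1 - 0) * a + 0)%R by rewrite subr0 mul1r addr0.
      apply: cvgD; last exact: cvg_r.
      by apply: cvgM => //; apply: cvgB; [exact: cvg_cst|exact: cvg_r].
    move: a0; rewrite le_eqVlt => /predU1P[a0|a0].
      rewrite -a0 inve0 (cvg_limn_einf_sup (_ : _ --> +oo)).1//.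
      apply/cvgeryP; apply/cvgrVy; last by rewrite a0.
      apply: nearW => n; have := fpos n x.
      by have /andP[? ?] := r01 n; nra.
    rewrite inver gt_eqF// (cvg_limn_einf_sup (_ : _ --> a^-1%:E)).1//.
    by apply: cvg_EFin; [exact: nearW|apply/cvgVP => //; rewrite gt_eqF].
  - by rewrite ltey_eq fin_num_measure.
have := integrable_ae measurableT ginv; apply: filterS => x /(_ I).
rewrite lt_def g0 andbT; apply: contraTN => /eqP ->.
by rewrite inve0.
Qed.

Lemma near_maximizing_limit_numeraire : numeraire H mu g.
Proof.
split => // e eH; apply: limle (eH) _ _ _.
- exact: measurable_evalue_ratio eH gH.
- by move=> x; exact: evalue_ratio_ge0 eH gH.
move: near_maximizing_cvg near_maximizing_limit_gt0 (evalue_lty mu_ac eH).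
apply: filterS3 => x [a [_ gE fa]]; rewrite gE lte_fin => a0 eoo.
have [_ e0 _] := eH.
have [b eE] : exists b, e x = b%:E.
  by exists (fine (e x)); rewrite fineK// ge0_fin_numE.
have cN : (N n)^-1%R @[n --> \oo] --> 0%R.
  apply: (@squeeze_cvgr _ _ _ _ (cst 0%R) r); last 2 first.
  - exact: cvg_cst.
  - exact: cvg_r.
  apply: nearW => n; rewrite invr_ge0 ltW//=.
  by rewrite (le_trans (Nr n))// expr2 ger_pMr// ltW.
have cb : e_ e n x @[n --> \oo] --> b.
  have -> : b = ((1 - 0) * b + 0 * 1)%R by rewrite subr0 mul1r mul0r addr0.
  apply: cvgD; last by apply: cvgM => //; exact: cvg_cst.
  apply: cvgM; first by apply: cvgB => //; exact: cvg_cst.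
  apply: cvg_near_cst.
  have /cvgryPge/(_ b) : N n @[n --> \oo] --> +oo%R.
    by apply/gtr0_cvgV0 => //; exact: nearW.
  apply: filterS => n bN; rewrite eE -EFin_min/=.
  exact/min_idPl.
rewrite eE inver gt_eqF// -EFinM.
under eq_fun do rewrite yE//.
rewrite (cvg_limn_einf_sup (_ : _ --> (b / a)%:E)).1//.
by apply: cvg_EFin; [exact: nearW|exact: cvg_mix_ratio cvg_r fa cb].
Qed.

End limit.

Lemma numeraire_exists : exists g, numeraire H mu g.
Proof.
have [N [f Nf]] := near_maximizing_exists.
by eexists; exact: near_maximizing_limit_numeraire Nf.
Qed.

End existence.

(** * The theorem *)

Theorem corollary7 (d : measure_display) (X : measurableType d)
    (R : realType) (H : set (probability X R)) (Q : probability X R)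
    (Qa : {finite_measure set X -> \bar R}) (Qs : {measure set X -> \bar R})
    (Qdec : generalized_Lebesgue_decomposition H Q Qa Qs)
    (Qa_gt0 : 0 < Qa [set: X]) :
  (exists elog : X -> \bar R,
    [/\ U_optimal H Qa (@lne R) elog,
        forall e, U_optimal H Qa (@lne R) e -> {ae Qa, forall x, e x = elog x}
      & {ae Qa, forall x, 0 < elog x}]) /\
  (forall elog : X -> \bar R, evalues H elog ->
    (U_optimal H Qa (@lne R) elog <->
      (forall e, evalues H e -> \int[Qa]_x (e x / elog x - 1) <= 0)) /\
    (U_optimal H Qa (@lne R) elog <->
      (exists Pstar : {finite_measure set X -> \bar R},
        [/\ effective_hypothesis H Pstar,
            Pstar `<< Qa /\ Qa `<< Pstar,
            {ae Qa, forall x, elog x =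
              (Qa [set: X])^-1 *
              ('d (charge_of_finite_measure Qa) '/d Pstar) x}
          & \int[Pstar]_x elog x = 1]))).
Proof.
have [_ _ Qa_ac] := Qdec; split.
  have [f fN] := numeraire_exists Qa_ac; exists f; split.
  - exact: numeraire_optimal.
  - by move=> e /(optimal_numeraire Qa_ac) eN; exact: (numeraire_unique Qa_ac).
  - exact: numeraire_gt0 fN.
move=> f fH; split.
  by rewrite (optimalP Qa_ac); exact: numeraireP.
rewrite (optimalP Qa_ac); split.
  exact: numeraire_dual_measure.
by move=> [P]; exact: dual_measure_numeraire.
Qed.
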